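(* Let $(\lambda_N)_{N\ge1}$ be a sequence of real numbers with $0<\lambda_N<1$ and $$\lambda_N\sqrt N\xrightarrow[N\to\infty]{}\infty.$$ Then, in the sequence of fractional binary markets, there are neither $1$-step $\{\lambda_N\}_{N\ge1}$-asymptotic arbitrage opportunities of the first kind nor $1$-step $\{\lambda_N\}_{N\ge1}$-asymptotic arbitrage opportunities of the second kind.
   Context: Fix $H\in(1/2,1)$, $\sigma>0$, $s_0>0$. Let $(\xi_i)_{i\ge1}$ be i.i.d. with $P(\xi_1=1)=P(\xi_1=-1)=1/2$, $\mathcal F_i=\sigma(\xi_1,\dots,\xi_i)$ ($\mathcal F_0$ and $\mathcal F_{-1}$ trivial), $\vec\xi_n=(\xi_1,\dots,\xi_n)$. Set $c_H=\sqrt{\frac{2H\,\Gamma(\frac32-H)}{\Gamma(H+\frac12)\,\Gamma(2-2H)}}$ and, for $n\ge1$, $1\le i\le n-1$, $$j_n(i)=\sigma c_H\left(H-\tfrac12\right)\int_{i-1}^{i}x^{\frac12-H}\left(\int_0^1 (v+n-1)^{H-\frac12}(v+n-1-x)^{H-\frac32}\,dv\right)dx,$$ $$g_n=\sigma c_H\left(H-\tfrac12\right)\int_{n-1}^{n}x^{\frac12-H}(n-x)^{H-\frac12}\left(\int_0^1 (y(n-x)+x)^{H-\frac12}y^{H-\frac32}\,dy\right)dx,$$ and $X_n=\sum_{i=1}^{n-1}j_n(i)\xi_i+g_n\xi_n$. The $N$-fractional binary market ($N>1$, without drift) has bond identically $1$ and stock $S^{(N)}_0=s_0$, $S_n^{(N)}=\left(1+\frac{X_n}{N^H}\right)S_{n-1}^{(N)}$,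 $1\le n\le N$. The variable $S^{(N)}_n$ is regarded as a function of $\vec\xi_n\in\{-1,1\}^n$. For a strategy $\phi=(\phi^0_n,\phi^1_n)_{n=-1}^N$ (adapted; $\phi^0$ units of bond, $\phi^1$ units of stock) and $\lambda\in[0,1]$, the liquidation value is $V_n^\lambda(\phi)=\phi_n^0+(1-\lambda)(\phi_n^1)^+S^{(N)}_n-(\phi_n^1)^-S^{(N)}_n$. A $1$-step $\lambda$-self-financing strategy (zero endowment) in the $N$-fractional binary market is a strategy of the following form, for some fixed $n\in\{1,\dots,N-1\}$, $A\subset\{-1,1\}^n$ and $q:\{-1,1\}^n\to\mathbb R_+$: $\phi^0_i=\phi^1_i=0$ for $i<n$; $$\phi_n^{0}=\sum_{\vec x\in A}1_{\{\vec\xi_n=\vec x\}}(1-\lambda)S_n^{(N)}(\vec x)q(\vec x)-\sum_{\vec x\in A^c}1_{\{\vec\xi_n=\vec x\}}S_n^{(N)}(\vec x)q(\vec x),$$ $$\phi_n^{1}=-\sum_{\vec x\in A}1_{\{\vec\xi_n=\vec x\}}q(\vec x)+\sum_{\vec x\in A^c}1_{\{\vec\xi_n=\vec x\}}q(\vec x);$$ and for all $k$ with $n+1\le k\le N$, $\phi^1_k=0$ and $$\phi_{k}^{0}=\sum_{\vec x\in A}1_{\{\vec\xi_n=\vec x\}}\left[(1-\lambda)S_n^{(N)}(\vec x)-S_{n+1}^{(N)}(\vec x,\xi_{n+1})\right]q(\vec x)-\sum_{\vec x\in A^c}1_{\{\vec\xi_n=\vec x\}}\left[S_n^{(N)}(\vec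 x)-(1-\lambda)S_{n+1}^{(N)}(\vec x,\xi_{n+1})\right]q(\vec x).$$ A $1$-step $\{\lambda_N\}$-asymptotic arbitrage of the first kind exists if there are a subsequence of markets (again denoted by $N$), $1$-step $\lambda_N$-self-financing strategies $\phi^N$ in the $N$-fractional binary market, and sequences of strictly positive reals $c_N\to0$, $C_N\to\infty$ such that $V_i^{\lambda_N}(\phi^N)\ge-c_N$ for all $i=0,\dots,N$ and $\lim_{N\to\infty}P(V_N^{\lambda_N}(\phi^N)\ge C_N)>0$. A $1$-step $\{\lambda_N\}$-asymptotic arbitrage of the second kind exists if there are a subsequence of markets (again denoted by $N$), $1$-step $\lambda_N$-self-financing strategies $\phi^N$ in the $N$-fractional binary market, and $\alpha>0$ such that $V_i^{\lambda_N}(\phi^N)\ge-1$ for all $i=0,\dots,N$ and $\lim_{N\to\infty}P(V_N^{\lambda_N}(\phi^N)\ge\alpha)=1$. *)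

(* Defs.v *)
From HB Require Import structures.
From mathcomp Require Import all_boot all_order all_algebra.
From mathcomp Require Import all_classical all_reals all_analysis.
Set Implicit Arguments.
Unset Strict Implicit.
Unset Printing Implicit Defensive.
Import Order.TTheory GRing.Theory Num.Theory.
Import numFieldNormedType.Exports.
Local Open Scope classical_set_scope.
Local Open Scope ring_scope.

(** For 1/2 < H < 1 all the integrals below converge, and every base of a
    power is nonnegative; the convention [0 `^ a = (a == 0)%:R] only matters on
    null sets. *)

Definition Gamma (R : realType) (z : R) : R :=
  \int[lebesgue_measure]_(t in `]0, +oo[) (t `^ (z - 1) * expR (- t)).

Definition cH (R : realType) (H : R) : R :=
  Num.sqrt (2 * H * Gamma (3 / 2 - H) / (Gamma (H + 1 / 2) * Gamma (2 - 2 * H))).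

Definition jcoef (R : realType) (H sigma : R) (n i : nat) : R :=
  sigma * cH H * (H - 1 / 2) *
  \int[lebesgue_measure]_(x in `[i%:R - 1, i%:R])
    (x `^ (1 / 2 - H) *
     \int[lebesgue_measure]_(v in `[0, 1])
       ((v + n%:R - 1) `^ (H - 1 / 2) * (v + n%:R - 1 - x) `^ (H - 3 / 2))).

Definition gcoef (R : realType) (H sigma : R) (n : nat) : R :=
  sigma * cH H * (H - 1 / 2) *
  \int[lebesgue_measure]_(x in `[n%:R - 1, n%:R])
    (x `^ (1 / 2 - H) * (n%:R - x) `^ (H - 1 / 2) *
     \int[lebesgue_measure]_(y in `[0, 1])
       ((y * (n%:R - x) + x) `^ (H - 1 / 2) * y `^ (H - 3 / 2))).

(** Mathematical indices start at 1, so that the coordinate x_i of a vector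
    (x_1, ..., x_n), encoded as a sequence of reals, is [x`_i.-1]. *)
Definition Xval (R : realType) (H sigma : R) (n : nat) (x : seq R) : R :=
  \sum_(1 <= i < n) jcoef H sigma n i * x`_i.-1 + gcoef H sigma n * x`_n.-1.

(** [stock H sigma s0 N n x] is S^(N)_n as a function of x = (x_1, ..., x_n);
    only the first n entries of [x] matter. *)
Fixpoint stock (R : realType) (H sigma s0 : R) (N n : nat) (x : seq R) : R :=
  match n with
  | 0 => s0
  | m.+1 => (1 + Xval H sigma m.+1 x / N%:R `^ H) * stock H sigma s0 N m x
  end.

(** A vector of {-1,1}^n is encoded by an [n.-tuple bool]. *)
Definition signs (R : realType) (n : nat) (x : n.-tuple bool) : seq R :=
  [seq (if b then 1 else -1) | b <- x].

Section Market.
Context d (T : measurableType d) (R : realType) (P : probability T R).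
Implicit Types (xi : nat -> {RV P >-> R}).

(** The variables are xi_1, xi_2, ...; the value [xi 0] is never used. *)
Definition mutually_independent xi : Prop :=
  forall (J : seq nat) (B : nat -> set R),
    uniq J -> all (fun i => 0 < i)%N J -> (forall i, measurable (B i)) ->
    P (\big[setI/setT]_(i <- J) (xi i @^-1` B i)) =
    (\prod_(i <- J) P (xi i @^-1` B i))%E.

Definition identically_distributed xi : Prop :=
  forall (i : nat) (B : set R), (0 < i)%N -> measurable B ->
    distribution P (xi i) B = distribution P (xi 1%N) B.

Definition iid_fair_signs xi : Prop :=
  [/\ mutually_independent xi,
      identically_distributed xi,
      P (xi 1%N @^-1` [set 1]) = (2^-1 : R)%:E
    & P (xi 1%N @^-1` [set -1]) = (2^-1 : R)%:E].

Definition xivec xi (n : nat) (w : T) : seq R :=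
  [seq xi i w | i <- iota 1 n].

(** sigma(xi_1, ..., xi_k), which is trivial for k <= 0. *)
Definition filtration xi (k : int) : set (set T) :=
  <<s [set C | exists (i : nat) (B : set R),
        [/\ (0 < i)%N, i%:Z <= k, measurable B & C = xi i @^-1` B] ]>>.

(** Only the times k = -1, ..., N are relevant in the N-th market. *)
Record strategy : Type := Strategy {
  bond_units : int -> T -> R;
  stock_units : int -> T -> R }.

Definition adapted xi (N : nat) (phi : strategy) : Prop :=
  forall (k : int) (B : set R), -1 <= k <= N%:Z -> measurable B ->
    filtration xi k (bond_units phi k @^-1` B) /\
    filtration xi k (stock_units phi k @^-1` B).

Definition liquidation_value (H sigma s0 : R) xi (N : nat) (lam : R)
    (phi : strategy) (n : nat) (w : T) : R :=
  let S := stock H sigma s0 N n (xivec xi n w) in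
  bond_units phi n w + (1 - lam) * (stock_units phi n)^\+ w * S
    - (stock_units phi n)^\- w * S.

Definition one_step_self_financing (H sigma s0 : R) xi (N : nat) (lam : R)
    (phi : strategy) : Prop :=
  adapted xi N phi /\
  exists (n : nat) (A : {set n.-tuple bool}) (q : n.-tuple bool -> R),
    let ind x w : R := (xivec xi n w == signs R x)%:R in
    let Sn (x : n.-tuple bool) := stock H sigma s0 N n (signs R x) in
    let Sn1 (x : n.-tuple bool) w :=
      stock H sigma s0 N n.+1 (rcons (signs R x) (xi n.+1 w)) in
    [/\ (1 <= n <= N.-1)%N,
        (forall x, 0 <= q x),
        (forall (i : int) w, -1 <= i < n%:Z ->
           bond_units phi i w = 0 /\ stock_units phi i w = 0),
        (forall w,
           bond_units phi n w =
             \sum_(x in A) ind x w * (1 - lam) * Sn x * q x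
             - \sum_(x in ~: A) ind x w * Sn x * q x /\
           stock_units phi n w =
             - (\sum_(x in A) ind x w * q x)
             + \sum_(x in ~: A) ind x w * q x)
      & (forall (k : nat) w, (n.+1 <= k <= N)%N ->
           stock_units phi k w = 0 /\
           bond_units phi k w =
             \sum_(x in A) ind x w * ((1 - lam) * Sn x - Sn1 x w) * q x
             - \sum_(x in ~: A) ind x w * (Sn x - (1 - lam) * Sn1 x w) * q x)].

(** The subsequence of markets is N = u 0 < u 1 < ...; the strategies and the
    constants are indexed by the position k in this subsequence. *)
Definition asymptotic_arbitrage1 (H sigma s0 : R) xi (lam : nat -> R) : Prop :=
  exists (u : nat -> nat) (phi : nat -> strategy) (c C : nat -> R),
    {homo u : k l / (k < l)%N} /\
    (forall k, (1 < u k)%N /\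
       one_step_self_financing H sigma s0 xi (u k) (lam (u k)) (phi k)) /\
    (forall k, 0 < c k /\ 0 < C k) /\
    c @ \oo --> 0 /\
    C @ \oo --> +oo /\
    (forall k i, (i <= u k)%N ->
       {ae P, forall w,
         - c k <=
         liquidation_value H sigma s0 xi (u k) (lam (u k)) (phi k) i w}) /\
    exists l : R, 0 < l /\
      (fun k => P [set w | C k <=
         liquidation_value H sigma s0 xi (u k) (lam (u k)) (phi k) (u k) w])
        @ \oo --> l%:E.

Definition asymptotic_arbitrage2 (H sigma s0 : R) xi (lam : nat -> R) : Prop :=
  exists (u : nat -> nat) (phi : nat -> strategy) (alpha : R),
    {homo u : k l / (k < l)%N} /\
    (forall k, (1 < u k)%N /\
       one_step_self_financing H sigma s0 xi (u k) (lam (u k)) (phi k)) /\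
    0 < alpha /\
    (forall k i, (i <= u k)%N ->
       {ae P, forall w,
         - 1 <=
         liquidation_value H sigma s0 xi (u k) (lam (u k)) (phi k) i w}) /\
    (fun k => P [set w | alpha <=
       liquidation_value H sigma s0 xi (u k) (lam (u k)) (phi k) (u k) w])
      @ \oo --> 1%:E.

End Market.

(* Main.v *)
(** The kernel scales like the increments of a process of Hurst index H: writing
    a = H - 1/2, the coefficients satisfy
      j_n(i) <= K n^a i^(-a) (n-i)^(a-1)  and  g_n <= K n^a,
    and the convolution sum_i i^(-a) (n-i)^(a-1) is bounded, so |X_n| <= C n^a and
    every relative return |X_n / N^H| is at most C / sqrt N.  Since lam_N sqrt N
    tends to infinity, for N large the cost lam_N exceeds every relative return
    (and lam_N < 1 keeps the stock positive), so each one-step round trip loses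
    money whatever its sign: the terminal value is almost surely <= 0, which
    rules out both kinds of arbitrage. *)
Require Import Defs.
From HB Require Import structures.
From mathcomp Require Import all_boot all_order all_algebra.
From mathcomp Require Import all_classical all_reals all_analysis.
From mathcomp Require Import measurable_realfun ring lra.
Set Implicit Arguments.
Unset Strict Implicit.
Unset Printing Implicit Defensive.
Import Order.TTheory GRing.Theory Num.Theory.
Import numFieldNormedType.Exports.
Local Open Scope classical_set_scope.
Local Open Scope ring_scope.

(** * Comparison of integrals *)

(* No measurability of [f] is needed: the integral of a nonnegative function is
   a supremum over the simple functions below it. *)
Lemma ge0_le_integral_nonmeasurable (d : measure_display) (T : measurableType d)
    (R : realType) (mu : {measure set T -> \bar R}) (D : set T) (f g : T -> R) :
  (forall x, D x -> 0 <= f x <= g x) ->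
  (\int[mu]_(x in D) (f x)%:E <= \int[mu]_(x in D) (g x)%:E)%E.
Proof.
move=> fg; rewrite ge0_integralE; last first.
  by move=> x /fg /andP[]; rewrite lee_fin.
rewrite ge0_integralE; last first.
  by move=> x /fg /andP[f0' fg']; rewrite lee_fin (le_trans f0').
apply: le_ereal_sup => _ [h /= hf <-]; exists h => //= x.
apply: (le_trans (hf x)); rewrite /patch; case: ifPn => // /set_mem /fg /andP[].
by rewrite lee_fin.
Qed.

(** A real-valued integral is the [fine] part of an extended one, which turns +oo into 0; the real
    bound [B] on the dominating integral makes the smaller one finite, so the inequality survives
    [fine]. This serves for the nested integrals of the kernel. *)
Lemma Rintegral_le_ub (d : measure_display) (T : measurableType d) (R : realType)
    (mu : {measure set T -> \bar R}) (D : set T) (f g : T -> R) (B : R) :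
  (forall x, D x -> 0 <= f x <= g x) ->
  (\int[mu]_(x in D) (g x)%:E <= B%:E)%E ->
  \int[mu]_(x in D) f x <= B.
Proof.
move=> fg gB; have fB := le_trans (ge0_le_integral_nonmeasurable mu fg) gB.
rewrite /Rintegral -lee_fin fineK// ge0_fin_numE; first exact: le_lt_trans fB (ltry _).
by apply: integral_ge0 => x /fg /andP[]; rewrite lee_fin.
Qed.

(** * Integrals of singular powers over unit intervals *)

Lemma ler_npowR (R : realType) (r x y : R) :
  r <= 0 -> 0 < x -> x <= y -> y `^ r <= x `^ r.
Proof.
move=> r0 x0 xy; have y0 := lt_le_trans x0 xy.
rewrite -[r]opprK !(powRN _ (- r)) lef_pV2 ?posrE ?powR_gt0//.
apply: ge0_ler_powR; rewrite ?nnegrE ?oppr_ge0 ?(ltW x0) ?(ltW y0)//.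
Qed.

(** The antiderivative x^b / b may fail to be differentiable at 0, so the fundamental theorem is
    applied on [e, 1]; e is sent to 0 afterwards. *)
Lemma integral_powR_away0 (R : realType) (b e : R) : 0 < b -> 0 < e < 1 ->
  (\int[lebesgue_measure]_(x in `[e, 1%R]) (x `^ (b - 1))%:E
    = (b^-1 - e `^ b / b)%:E)%E.
Proof.
move=> b0 /andP[e0 e1].
have dF (x : R) : 0 < x -> is_derive x 1 (fun x : R => b^-1 * x `^ b) (x `^ (b - 1)).
  move=> x0; have dx := is_derive1_powR b x0.
  apply: is_derive_eq; rewrite /GRing.scale /= mulKf ?gt_eqF//.
have cp (c x : R) : 0 < x -> {for x, continuous (fun x : R => x `^ c)}.
  move=> x0; apply: differentiable_continuous; apply/derivable1_diffP.
  by apply: derivable_powR; rewrite in_itv/= x0.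
rewrite (@continuous_FTC2 _ _ (fun x : R => b^-1 * x `^ b))//.
- by rewrite powR1 mulr1 [e `^ b / b]mulrC EFinB.
- apply: continuous_in_subspaceT => x; rewrite inE/= in_itv/= => /andP[ex _].
  by apply: cp; exact: lt_le_trans ex.
- have cF (x : R) : 0 < x -> {for x, continuous (fun x : R => b^-1 * x `^ b)}.
    by move=> x0; apply: cvgZr; exact: cp.
  split.
  + move=> x; rewrite in_itv/= => /andP[ex _].
    by have [] := dF x (lt_trans e0 ex).
  + by apply: cvg_at_right_filter; exact: cF.
  + by apply: cvg_at_left_filter; exact: cF.
- move=> x; rewrite in_itv/= => /andP[ex _].
  by rewrite derive1E; have [] := dF x (lt_trans e0 ex).
Qed.

(** Since b - 1 < 0, the shift only lowers the integrand, and t = 0 is the worst case. That integral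
    is the monotone limit of integrals over intervals away from 0, each at most 1/b. *)
Lemma integral_shifted_powR_le (R : realType) (b t : R) : 0 < b < 1 -> 0 <= t ->
  (\int[lebesgue_measure]_(x in `[0%R, 1%R]) ((x + t) `^ (b - 1))%:E <= (b^-1)%:E)%E.
Proof.
move=> /andP[b0 b1] t0.
have mp s D : measurable_fun D (fun x : R => (x + s) `^ (b - 1)).
  apply: measurable_funTS; apply:
    (@measurableT_comp _ _ _ _ _ _ (@powR R ^~ (b - 1))) => //.
  exact: measurable_funD.
have mp0 D : measurable_fun D (fun x : R => x `^ (b - 1)).
  by apply: measurable_funTS; exact: measurable_powR.
(* The endpoint 0 must go: by convention 0 to a nonzero power is 0, so the pointwise comparison
   fails there when t > 0. *)
rewrite -integral_itv_obnd_cbnd; last by apply/measurable_EFinP; exact: mp.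
apply: (@le_trans _ _
    (\int[lebesgue_measure]_(x in `]0%R, 1%R]) (x `^ (b - 1))%:E)%E).
  apply: ge0_le_integral => //=.
  - by move=> x _; rewrite lee_fin powR_ge0.
  - by apply/measurable_EFinP; exact: mp.
  - by apply/measurable_EFinP; exact: mp0.
  - move=> x; rewrite in_itv/= => /andP[x0 _]; rewrite lee_fin.
    by apply: ler_npowR => //; [lra|rewrite lerDl].
(* Starting at 1/2 keeps the left endpoint strictly inside (0, 1). *)
pose F (n : nat) : set R := `[n.+2%:R^-1, 1%R]%classic.
have F0 n x : F n x -> 0 < x.
  by rewrite /F/= in_itv/= => /andP[+ _]; apply: lt_le_trans; rewrite invr_gt0.
have -> : `]0%R, 1%R]%classic = \bigcup_n F n.
  apply/seteqP; split=> x /=.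
    rewrite in_itv/= => /andP[x0 x1]; exists (Num.truncn x^-1) => //=.
    rewrite /F/= in_itv/= x1 andbT invf_ple ?posrE//.
    apply/ltW/(lt_trans (truncnS_gt _)); by rewrite ltr_nat.
  by move=> [n _ Fx]; rewrite in_itv/= (F0 n)//; move: Fx; rewrite /F/= in_itv/= => /andP[].
have cv : (\int[lebesgue_measure]_(x in F n) (x `^ (b - 1))%:E @[n --> \oo] -->
    \int[lebesgue_measure]_(x in \bigcup_n F n) (x `^ (b - 1))%:E)%E.
  apply: ge0_nondecreasing_set_cvg_integral => //.
  - apply/nondecreasing_seqP => n; apply/subsetPset => x; rewrite /F/= !in_itv/=.
    move=> /andP[nx ->]; rewrite andbT; apply: le_trans nx.
    by rewrite lef_pV2 ?posrE// ler_nat.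
  - by move=> n; exact: measurable_itv.
  - by move=> n; apply/measurable_EFinP; exact: mp0.
  - by move=> n x _; rewrite lee_fin powR_ge0.
rewrite -(cvg_lim _ cv)//; apply: lime_le; first by apply/cvg_ex; eexists; exact: cv.
apply: nearW => n; rewrite integral_powR_away0//.
  by rewrite lee_fin gerBl divr_ge0 ?powR_ge0// ltW.
by rewrite invr_gt0 ltr0n/= invf_lt1// ltr1n.
Qed.

Lemma powR_half_le (R : realType) (b x : R) : 0 <= b -> 0 < x ->
  (x / 2) `^ (b - 1) <= 2 * x `^ (b - 1).
Proof.
move=> b0 x0; rewrite powRM ?invr_ge0 ?(ltW x0)// mulrC.
rewrite ler_pM2r ?powR_gt0//.
have h : 2^-1 `^ (-1) = 2 :> R by rewrite powR_inv1 ?invrK.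
by rewrite -[leRHS]h; apply: ger_powR; lra.
Qed.

(** Halving the base costs a factor 2^(1-b), which is at most 2. This controls a singular power far
    from its singularity. *)
Lemma powR_le_far (R : realType) (b x y : R) : 0 <= b <= 1 -> 0 < x ->
  x / 2 <= y -> y `^ (b - 1) <= 2 * x `^ (b - 1).
Proof.
move=> /andP[b0 b1] x0 xy; apply: le_trans (powR_half_le b0 x0).
by apply: ler_npowR => //; lra.
Qed.

Lemma unit_integral_le (R : realType) (c K : R) (f : R -> R) :
  (forall x, x \in `[c, c + 1] -> 0 <= f x <= K) ->
  (\int[lebesgue_measure]_(x in `[c, (c + 1)%R]) (f x)%:E <= K%:E)%E.
Proof.
move=> fK; have -> : (K%:E = \int[lebesgue_measure]_(x in `[c, (c + 1)%R]) (K%:E))%E.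
  rewrite integral_cst//= lebesgue_measure_itv/= lte_fin ltrDl ltr01 -EFinD.
  by rewrite addrAC subrr add0r mule1.
exact: ge0_le_integral_nonmeasurable.
Qed.

(** For m = 1 the interval may touch the singularity, and the integral is at most 1/b. For m >= 2
    the base is at least m - 1 >= m/2, so the integrand is at most 2 m^(b-1), and 1/b >= 1 allows
    one constant for both cases. *)
Lemma integral_shifted_powR_le_powR (R : realType) (b t : R) (m : nat) :
  0 < b < 1 -> (0 < m)%N -> m%:R - 1 <= t ->
  (\int[lebesgue_measure]_(x in `[0%R, 1%R]) ((x + t) `^ (b - 1))%:E
    <= (2 / b * m%:R `^ (b - 1))%:E)%E.
Proof.
move=> /andP[b0 b1]; case: m => // -[|m] _ mt.
  apply: le_trans (integral_shifted_powR_le _ _) _; [lra|lra|].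
  by rewrite powR1 lee_fin mulr1 ler_peMl ?invr_ge0 ?ltW//; lra.
have m0 : 0 <= m%:R :> R by [].
rewrite -[X in `[_, X]](add0r 1).
apply: unit_integral_le => x; rewrite in_itv/= powR_ge0/= => /andP[x0 _].
have := @powR_le_far R b m.+2%:R (x + t).
have mE : m.+2%:R = m%:R + 2 :> R by rewrite -natrD addn2.
rewrite mE in mt *; move=> /(_ _ _ _)/le_trans; apply; [lra|lra|lra|].
by rewrite ler_wpM2r ?powR_ge0 ?ler_pdivlMr//; lra.
Qed.

Lemma integral_powR_le_powR (R : realType) (b : R) (i : nat) :
  0 < b < 1 -> (0 < i)%N ->
  (\int[lebesgue_measure]_(x in `[(i%:R - 1)%R, i%:R]) (x `^ (b - 1))%:E
    <= (2 / b * i%:R `^ (b - 1))%:E)%E.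
Proof.
move=> /andP[b0 b1]; case: i => // -[|i] _.
  rewrite subrr; have := @integral_shifted_powR_le_powR R b 0 1.
  under eq_integral do rewrite addr0.
  by apply=> //; lra.
have i0 : 0 <= i%:R :> R by [].
rewrite -[X in `[_, X]](subrK 1).
apply: unit_integral_le => x; rewrite in_itv/= powR_ge0/= => /andP[x0 _].
have := @powR_le_far R b i.+2%:R x.
have iE : i.+2%:R = i%:R + 2 :> R by rewrite -natrD addn2.
rewrite iE in x0 *; move=> /(_ _ _ _)/le_trans; apply; [lra|lra|lra|].
by rewrite ler_wpM2r ?powR_ge0 ?ler_pdivlMr//; lra.
Qed.

Lemma integral_scale_powR (R : realType) (D : set R) (K b t : R) :
  measurable D -> 0 <= K ->
  (\int[lebesgue_measure]_(x in D) (K * (x + t) `^ b)%:E =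
   K%:E * \int[lebesgue_measure]_(x in D) ((x + t) `^ b)%:E)%E.
Proof.
move=> mD K0; under eq_integral do rewrite EFinM.
apply: ge0_integralZl_EFin => //; first by move=> x _; rewrite lee_fin powR_ge0.
apply/measurable_EFinP/measurable_funTS.
apply: (@measurableT_comp _ _ _ _ _ _ (@powR R ^~ b)) => //.
exact: measurable_funD.
Qed.

(** * Bounds on the coefficients j_n(i) and g_n *)

(** The last exponent, -a, is kept in the form b - 1 with b = 1 - a, to match the integral bounds
    above. *)
Lemma hurst_exponents (R : realType) (a : R) :
  (a + 1 / 2 - 1 / 2 = a) * (a + 1 / 2 - 3 / 2 = a - 1) *
  (1 / 2 - (a + 1 / 2) = 1 - a - 1).
Proof. by split; [split|]; field. Qed.

(** The three factors come from v + n - 1 <= n, from the v-integral with shift n - 1 - x >= (n - i)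
    - 1, and from the x-integral over the i-th cell. *)
Lemma jcoef_bound (R : realType) (a sigma : R) (n i : nat) :
  0 < a < 1 -> (0 < i < n)%N ->
  `|jcoef (a + 1 / 2) sigma n i| <= `|sigma * cH (a + 1 / 2) * a| *
    (n%:R `^ a * (2 / a * (n - i)%:R `^ (a - 1)) * (2 / (1 - a) * i%:R `^ ((1 - a) - 1))).
Proof.
move=> /andP[a_gt0 a_lt1] /andP[i0 iltn]; rewrite /jcoef !hurst_exponents normrM ler_wpM2l//.
set B := n%:R `^ a * _.
have B0 : 0 <= B.
  by rewrite /B !mulr_ge0 ?powR_ge0 ?invr_ge0 ?(ltW a_gt0).
have in_ge0 x : 0 <= \int[lebesgue_measure]_(v in `[0, 1])
       ((v + n%:R - 1) `^ a * (v + n%:R - 1 - x) `^ (a - 1)).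
  by apply: Rintegral_ge0 => v _; rewrite mulr_ge0 ?powR_ge0.
rewrite ger0_norm; last first.
  by apply: Rintegral_ge0 => x _; rewrite mulr_ge0 ?powR_ge0.
(* The shift by 0 brings the majorant into the form of [integral_scale_powR]. *)
apply: (@Rintegral_le_ub _ _ R lebesgue_measure _ _
    (fun x : R => B * (x + 0) `^ ((1 - a) - 1))); last first.
  rewrite integral_scale_powR// [leRHS]EFinM lee_wpmul2l ?lee_fin//.
  under eq_integral do rewrite addr0.
  by apply: integral_powR_le_powR => //; lra.
move=> x /=; rewrite in_itv/= addr0 => /andP[_ xi].
rewrite mulr_ge0 ?powR_ge0//= mulrC ler_wpM2r ?powR_ge0//.
apply: (@Rintegral_le_ub _ _ R lebesgue_measure _ _
    (fun v : R => n%:R `^ a * (v + (n%:R - 1 - x)) `^ (a - 1))); last first.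
  rewrite integral_scale_powR ?powR_ge0// /B [leRHS]EFinM lee_wpmul2l ?lee_fin ?powR_ge0//.
  apply: integral_shifted_powR_le_powR; [lra|by rewrite subn_gt0|].
  by rewrite natrB 1?ltnW//; lra.
have n1 : 1 <= n%:R :> R by rewrite ler1n (leq_ltn_trans _ iltn).
move=> v /=; rewrite in_itv/= => /andP[v0 v1].
rewrite mulr_ge0 ?powR_ge0//= !addrA ler_wpM2r ?powR_ge0//.
by apply: ge0_ler_powR; rewrite ?nnegrE ?(ltW a_gt0)//; lra.
Qed.

(** On the last cell y(n - x) + x <= n and (n - x)^a <= 1, while the y-integral is at most 1/a. *)
Lemma gcoef_bound (R : realType) (a sigma : R) (n : nat) :
  0 < a < 1 -> (0 < n)%N ->
  `|gcoef (a + 1 / 2) sigma n| <= `|sigma * cH (a + 1 / 2) * a| *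
    (n%:R `^ a / a * (2 / (1 - a))).
Proof.
move=> /andP[a_gt0 a_lt1] n0; rewrite /gcoef !hurst_exponents normrM ler_wpM2l//.
have n1 : 1 <= n%:R :> R by rewrite ler1n.
set B := n%:R `^ a / _.
have B0 : 0 <= B by rewrite /B mulr_ge0 ?powR_ge0 ?invr_ge0 ?(ltW a_gt0).
have in_ge0 x : 0 <= \int[lebesgue_measure]_(y in `[0, 1])
       ((y * (n%:R - x) + x) `^ a * y `^ (a - 1)).
  by apply: Rintegral_ge0 => v _; rewrite mulr_ge0 ?powR_ge0.
rewrite ger0_norm; last first.
  by apply: Rintegral_ge0 => x _; rewrite !mulr_ge0 ?powR_ge0.
apply: (@Rintegral_le_ub _ _ R lebesgue_measure _ _
    (fun x : R => B * (x + 0) `^ ((1 - a) - 1))); last first.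
  rewrite integral_scale_powR// [leRHS]EFinM lee_wpmul2l ?lee_fin//.
  under eq_integral do rewrite addr0.
  apply: le_trans (integral_powR_le_powR _ _) _; [lra|by []|].
  (* The decay n^(-a) of the x-integral is bounded by 1; what remains is still of order n^a. *)
  rewrite lee_fin ler_piMr ?divr_ge0//; first by lra.
  by rewrite -[leRHS](powRr0 n%:R) ler_powR//; lra.
move=> x /=; rewrite in_itv/= addr0 => /andP[nx xn].
rewrite !mulr_ge0 ?powR_ge0//= -mulrA mulrC ler_wpM2r ?powR_ge0//.
apply: (@le_trans _ _ (1 * B)); last by rewrite mul1r.
apply: ler_pM => //; first exact: powR_ge0.
  have h1 : 1 `^ a = 1 :> R by rewrite powR1.
  rewrite -[leRHS]h1.
  by apply: ge0_ler_powR; rewrite ?nnegrE ?(ltW a_gt0)//; lra.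
apply: (@Rintegral_le_ub _ _ R lebesgue_measure _ _
    (fun v : R => n%:R `^ a * (v + 0) `^ (a - 1))); last first.
  rewrite integral_scale_powR ?powR_ge0// /B [leRHS]EFinM lee_wpmul2l ?lee_fin ?powR_ge0//.
  by apply: integral_shifted_powR_le; lra.
move=> v /=; rewrite in_itv/= addr0 => /andP[v0 v1].
rewrite mulr_ge0 ?powR_ge0//= ler_wpM2r ?powR_ge0//.
apply: ge0_ler_powR; rewrite ?nnegrE ?(ltW a_gt0)//; nra.
Qed.

(** * Power sums and their convolution *)

(* Young's inequality for [x `^ b * y `^ (1 - b)], divided by [y `^ (1 - b)]. *)
Lemma powR_tangent_le (R : realType) (b x y : R) : 0 < b < 1 -> 0 <= x -> 0 < y ->
  x `^ b <= (b * x + (1 - b) * y) * y `^ (b - 1).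
Proof.
move=> /andP[b0 b1] x0 y0; have c0 : 0 < 1 - b by lra.
have := @conjugate_powR R (x `^ b) (y `^ (1 - b)) b^-1 (1 - b)^-1.
rewrite -!powRrM !divff ?gt_eqF// !powRr1 ?(ltW y0)// !invrK !invr_gt0 !powR_ge0.
move=> /(_ isT isT b0 c0 (subrKC _ _)) h.
have yy : y `^ (1 - b) * y `^ (b - 1) = 1.
  by rewrite -powRD ?(gt_eqF y0) ?implybT// (_ : 1 - b + (b - 1) = 0) ?powRr0//; ring.
rewrite -[leLHS]mulr1 -[X in _ * X <= _]yy mulrA ler_wpM2r ?powR_ge0//.
by apply: le_trans h _; rewrite mulrC [y * _]mulrC.
Qed.

(** Concavity of x^b at m + 1 gives b (m+1)^(b-1) <= (m+1)^b - m^b, and these differences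
    telescope. *)
Lemma sum_powR_le (R : realType) (b : R) (n : nat) : 0 < b < 1 ->
  \sum_(1 <= i < n) i%:R `^ (b - 1) <= n%:R `^ b / b.
Proof.
move=> /andP[b0 b1]; case: n => [|n]; first by rewrite big_geq// divr_ge0 ?powR_ge0 ?ltW.
(* The induction needs the last summed index m on the right; replacing it by m + 1 is
   monotonicity. *)
have step m : \sum_(1 <= i < m.+1) i%:R `^ (b - 1) <= m%:R `^ b / b.
  elim: m => [|m IH]; first by rewrite big_geq// divr_ge0 ?powR_ge0 ?ltW.
  rewrite big_nat_recr//=; apply: le_trans (lerD IH (lexx _)) _.
  have m0 : 0 < m.+1%:R :> R by [].
  have := @powR_tangent_le R b m%:R m.+1%:R; rewrite b0 b1 => /(_ isT).
  move=> /(_ (ler0n _ _) m0).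
  have -> : b * m%:R + (1 - b) * m.+1%:R = m.+1%:R - b by rewrite -natr1; ring.
  rewrite mulrBl mulr_powRB1// => h.
  rewrite -(ler_pM2r b0) mulrDl !divfK ?gt_eqF//.
  by rewrite [_ * b]mulrC; lra.
apply: le_trans (step n) _; rewrite ler_wpM2r ?invr_ge0 ?(ltW b0)//.
by apply: ge0_ler_powR; rewrite ?nnegrE ?ler_nat ?(ltW b0)//.
Qed.

(* At each index, one of the two factors has its base at least [n / 2]. *)
Lemma convolution_powR_le (R : realType) (a : R) (n : nat) :
  0 < a < 1 -> (0 < n)%N ->
  \sum_(1 <= i < n) (n - i)%:R `^ (a - 1) * i%:R `^ ((1 - a) - 1)
    <= 2 / a + 2 / (1 - a).
Proof.
move=> /andP[a0 a1] n0; have b0 : 0 < 1 - a by lra.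
have nR : 0 < n%:R :> R by rewrite ltr0n.
apply: (@le_trans _ _ (\sum_(1 <= i < n)
    ((n - i)%:R `^ (a - 1) * (2 * n%:R `^ ((1 - a) - 1)) +
     2 * n%:R `^ (a - 1) * i%:R `^ ((1 - a) - 1)))).
  apply: ler_sum_nat => i /andP[i1 iltn].
  have [ni|ni] := leP (n%:R / 2) (i%:R : R).
    rewrite ler_wpDr// ?mulr_ge0 ?powR_ge0// ler_wpM2l ?powR_ge0//.
    by apply: powR_le_far => //; lra.
  rewrite ler_wpDl// ?mulr_ge0 ?powR_ge0// ler_wpM2r ?powR_ge0//.
  by apply: powR_le_far => //; rewrite ?natrB 1?ltnW//; lra.
rewrite big_split/= -mulr_suml -mulr_sumr.
have rev : \sum_(1 <= i < n) (n - i)%:R `^ (a - 1) = \sum_(1 <= i < n) i%:R `^ (a - 1) :> R.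
  rewrite big_nat_rev/= [LHS]big_nat [RHS]big_nat; apply: eq_bigr => i /andP[i1 iltn].
  by rewrite add1n subSS subKn// ltnW.
rewrite rev.
(* Each power sum is of order n^c and carries a factor n^(-c), for c = a and c = 1 - a, so the
   powers of n cancel. *)
have pw c : n%:R `^ c * n%:R `^ ((1 - c) - 1) = 1 :> R.
  rewrite -powRD ?(gt_eqF nR) ?implybT//.
  by rewrite (_ : c + (1 - c - 1) = 0) ?powRr0//; ring.
apply: lerD.
  apply: le_trans (ler_wpM2r _ (sum_powR_le n _)) _; rewrite ?mulr_ge0 ?powR_ge0//.
    by rewrite a0.
  by rewrite mulrCA mulrAC pw mul1r.
apply: le_trans (ler_wpM2l _ (sum_powR_le n _)) _; rewrite ?mulr_ge0 ?powR_ge0//.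
  by apply/andP; split; lra.
have := pw (1 - a); rewrite (_ : 1 - (1 - a) - 1 = a - 1); last by ring.
move=> h; rewrite -[leRHS]mulr1 -[X in _ <= _ * X]h le_eqVlt.
by apply/orP; left; apply/eqP; ring.
Qed.

(** * Size of the relative returns *)

(** Asking only that entries be at most 1 in absolute value also admits the default entry 0 beyond
    the end of a list. *)
Lemma Xval_bound (R : realType) (H sigma : R) : 1 / 2 < H < 1 ->
  exists2 C : R, 0 <= C & forall (n : nat) (x : seq R), (0 < n)%N ->
    (forall i, `|x`_i| <= 1) -> `|Xval H sigma n x| <= C * n%:R `^ (H - 1 / 2).
Proof.
move=> /andP[H12 H1]; set a := H - 1 / 2.
have Ha : H = a + 1 / 2 by rewrite /a; ring.
have a01 : 0 < a < 1 by rewrite /a; lra.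
have /andP[a0 a1] := a01.
clearbody a; subst H.
set K := `|sigma * cH (a + 1 / 2) * a|.
have K0 : 0 <= K by exact: normr_ge0.
pose c := 2 / a * (2 / (1 - a)).
have c0 : 0 <= c by rewrite /c mulr_ge0 ?divr_ge0//; lra.
pose e := 2 / a + 2 / (1 - a).
have e0 : 0 <= e by rewrite /e addr_ge0 ?divr_ge0//; lra.
(* Here [c] collects the constants of the bound on j_n(i), [e] bounds the convolution, and the
   second summand comes from g_n. *)
exists (K * (c * e + a^-1 * (2 / (1 - a)))).
  by rewrite mulr_ge0 ?addr_ge0 ?mulr_ge0 ?invr_ge0//; lra.
move=> n x n0 x1; rewrite /Xval (le_trans (ler_normD _ _))//.
rewrite mulrDr mulrDl lerD//; last first.
  rewrite normrM (le_trans (ler_piMr _ _))//.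
  have := gcoef_bound sigma a01 n0; rewrite -/K => /le_trans; apply.
  by rewrite le_eqVlt; apply/orP; left; apply/eqP; ring.
apply: le_trans (ler_norm_sum _ _ _) _.
apply: (@le_trans _ _ (\sum_(1 <= i < n) K * c * n%:R `^ a *
    ((n - i)%:R `^ (a - 1) * i%:R `^ ((1 - a) - 1)))).
  apply: ler_sum_nat => i ilt; rewrite normrM (le_trans (ler_piMr _ _))//.
  have := jcoef_bound sigma a01 ilt; rewrite -/K => /le_trans; apply.
  by rewrite le_eqVlt; apply/orP; left; apply/eqP; rewrite /c; ring.
rewrite -mulr_sumr; apply: le_trans (ler_wpM2l _ (convolution_powR_le _ _)) _ => //.
  exact: mulr_ge0 (mulr_ge0 K0 c0) (powR_ge0 _ _).
by rewrite le_eqVlt; apply/orP; left; apply/eqP; rewrite -/e; ring.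
Qed.

(** For n <= N, n^(H-1/2) / N^H <= N^(-1/2), so the bound is uniform over all times of the N-th
    market. *)
Lemma relative_return_bound (R : realType) (H sigma : R) : 1 / 2 < H < 1 ->
  exists2 C : R, 0 <= C & forall (N n : nat) (x : seq R), (0 < n <= N)%N ->
    (forall i, `|x`_i| <= 1) ->
    `|Xval H sigma n x / N%:R `^ H| <= C / Num.sqrt N%:R.
Proof.
move=> Hr; have [C C0 XC] := @Xval_bound R H sigma Hr; exists C => // N n x.
move=> /andP[n0 nN] x1; have /andP[H12 H1] := Hr.
have NR : 0 < N%:R :> R by rewrite ltr0n (leq_trans n0).
have NH : 0 < N%:R `^ H :> R by exact: powR_gt0.
rewrite normrM normfV (ger0_norm (ltW NH)) ler_pdivrMr//.
apply: le_trans (XC _ _ n0 x1) _; rewrite -mulrA ler_wpM2l//.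
rewrite -powR12_sqrt ?ler0n// -powRN -powRD ?(gt_eqF NR) ?implybT//.
rewrite (_ : - 2^-1 + H = H - 1 / 2); last by field.
by apply: ge0_ler_powR; rewrite ?nnegrE ?ler_nat//; lra.
Qed.

(** * Loss of a single round trip *)

Lemma eq_stock (R : realType) (H sigma s0 : R) (N n : nat) (x y : seq R) :
  (forall i, (i < n)%N -> x`_i = y`_i) ->
  stock H sigma s0 N n x = stock H sigma s0 N n y.
Proof.
elim: n => //= n IH xy; rewrite IH => [|i iltn]; last by rewrite xy// ltnW.
congr ((1 + _ / _) * _); rewrite /Xval xy//; congr (_ + _).
apply: eq_big_nat => i /andP[i0 iltn]; rewrite xy// prednK//; exact: ltnW.
Qed.

Lemma stock_gt0 (R : realType) (H sigma s0 : R) (N n : nat) (x : seq R) :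
  0 < s0 ->
  (forall m, (0 < m <= n)%N -> `|Xval H sigma m x / N%:R `^ H| < 1) ->
  0 < stock H sigma s0 N n x.
Proof.
move=> s00; elim: n => //= n IH xb; rewrite mulr_gt0 ?IH//; last first.
  by move=> m /andP[m0 mn]; rewrite xb// m0 ltnW.
by have := xb n.+1; rewrite leqnn => /(_ isT); rewrite ltr_norml; lra.
Qed.

(** With S_{n+1} = (1 + Y) S_n and |Y| < lam, the short trip yields (-lam - Y) S_n <= 0, and the
    long one costs 1 - (1 - lam)(1 + Y) >= 0 times S_n. *)
Lemma one_step_gain_le0 (R : realType) (H sigma s0 lam y : R) (N n : nat)
    (x : n.-tuple bool) :
  0 < s0 -> 0 < lam < 1 -> (n < N)%N -> `|y| <= 1 ->
  (forall m (z : seq R), (0 < m <= N)%N -> (forall i, `|z`_i| <= 1) ->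
    `|Xval H sigma m z / N%:R `^ H| < lam) ->
  let Sn := stock H sigma s0 N n (signs R x) in
  let Sn1 := stock H sigma s0 N n.+1 (rcons (signs R x) y) in
  (1 - lam) * Sn - Sn1 <= 0 /\ 0 <= Sn - (1 - lam) * Sn1.
Proof.
move=> s00 /andP[l0 l1] nN y1 Xl Sn Sn1.
have x1 i : `|(signs R x)`_i| <= 1.
  have [ilt|ige] := ltnP i (size x); last first.
    by rewrite nth_default ?size_map// normr0.
  by rewrite (nth_map true)//; case: nth; rewrite ?normrN normr1.
have xy1 i : `|(rcons (signs R x) y)`_i| <= 1.
  by rewrite nth_rcons; case: ifP => // _; case: ifP => // _; rewrite normr0.
have Sn0 : 0 < Sn.
  apply: stock_gt0 => // m /andP[m0 mn]; apply: lt_trans l1; apply: Xl => //.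
  by rewrite m0 (leq_trans mn)// ltnW.
have Sn1E : Sn1 = (1 + Xval H sigma n.+1 (rcons (signs R x) y) / N%:R `^ H) * Sn.
  rewrite /Sn1/=; congr (_ * _); apply: eq_stock => i ilt.
  by rewrite nth_rcons size_map size_tuple ilt.
have := Xl n.+1 _ _ xy1; rewrite nN => /(_ isT).
rewrite ltr_norml Sn1E; set Y := Xval _ _ _ _ / _ => /andP[Y0 Y1].
rewrite -mulrBl mulrA -[X in 0 <= X - _]mul1r -mulrBl; split.
  by apply: mulr_le0_ge0; [lra|exact: ltW].
(* The factor equals (lam - Y) + lam Y, nonnegative when Y >= 0, and also lam - (1 - lam) Y,
   nonnegative when Y < 0. *)
by apply: mulr_ge0; [have [] := leP 0 Y; nra|exact: ltW].
Qed.

(** * Almost sure sign of the terminal value *)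

Lemma filtration_measurable (d : measure_display) (T : measurableType d)
    (R : realType) (P : probability T R) (xi : nat -> {RV P >-> R}) (k : int) :
  filtration xi k `<=` measurable.
Proof.
apply: smallest_sub; first exact: sigma_algebra_measurable.
by move=> _ [i [B [_ _ mB ->]]]; rewrite -[X in measurable X]setTI; exact: measurable_funPT.
Qed.

Section Market.
Context (d : measure_display) (T : measurableType d) (R : realType)
  (P : probability T R) (H sigma s0 : R) (xi : nat -> {RV P >-> R}).

(** As n <= N - 1, the stock position is closed by time N and only the bond account remains. *)
Lemma liquidation_value_terminal (N : nat) (lam : R) (phi : strategy T R) (w : T) :
  one_step_self_financing H sigma s0 xi N lam phi ->
  liquidation_value H sigma s0 xi N lam phi N w = bond_units phi N w.
Proof.
move=> [_ [n [A [q [/andP[n1 nN] _ _ _ /(_ N w)]]]]].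
rewrite leqnn andbT => /(_ _)[|sN _].
  by case: N nN => [|N] //; rewrite leqNgt n1.
rewrite /liquidation_value /funrpos /funrneg sN oppr0 maxxx.
by rewrite mulr0 mul0r addr0 subr0.
Qed.

(** Past signs enter only through the deterministic vectors [signs R x], so the sole condition on
    [w] concerns the next variable, m = n + 1. Every summand is then a round-trip loss weighted by
    an indicator and q >= 0. *)
Lemma one_step_liquidation_le0 (N : nat) (lam : R) (phi : strategy T R) :
  0 < s0 -> 0 < lam < 1 ->
  (forall m (z : seq R), (0 < m <= N)%N -> (forall i, `|z`_i| <= 1) ->
    `|Xval H sigma m z / N%:R `^ H| < lam) ->
  one_step_self_financing H sigma s0 xi N lam phi ->
  exists2 m : nat, (0 < m)%N & forall w, `|xi m w| <= 1 ->
    liquidation_value H sigma s0 xi N lam phi N w <= 0.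
Proof.
move=> s00 l01 Xl sf; have [_ [n [A [q [/andP[n1 nN] q0 _ _ Hk]]]]] := sf.
have {}nN : (n < N)%N by case: N nN {Xl sf Hk} => [|N] //; rewrite leqNgt n1.
exists n.+1 => // w xi1; rewrite liquidation_value_terminal//.
have [|_ ->] := Hk N w; first by rewrite nN leqnn.
rewrite -oppr_ge0 opprB subr_ge0; apply: (@le_trans _ _ 0).
  apply: sumr_le0 => x _; rewrite mulr_le0_ge0// mulr_ge0_le0//.
  by have [] := @one_step_gain_le0 R H sigma s0 lam (xi n.+1 w) N n x s00 l01 nN xi1 Xl.
apply: sumr_ge0 => x _; rewrite mulr_ge0// mulr_ge0//.
by have [] := @one_step_gain_le0 R H sigma s0 lam (xi n.+1 w) N n x s00 l01 nN xi1 Xl.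
Qed.

(** The two atoms 1 and -1 carry the whole mass 1/2 + 1/2, first for xi_1 and then for xi_m by
    equality of laws. *)
Lemma fair_sign_bounded_ae (m : nat) : iid_fair_signs xi -> (0 < m)%N ->
  P [set w | ~ (`|xi m w| <= 1)] = 0%E.
Proof.
move=> [_ idd p1 pN1] m0.
have mS (r : R) : measurable [set r] by exact: measurable_set1.
have mxi i (B : set R) : measurable B -> measurable (xi i @^-1` B).
  by move=> mB; rewrite -[X in measurable X]setTI; exact: measurable_funPT.
have PB : P (xi m @^-1` ([set 1] `|` [set -1])) = 1%E.
  have := @idd m ([set 1] `|` [set -1]) m0.
  rewrite /distribution /pushforward => -> //; last exact: measurableU.
  rewrite preimage_setU measureU//.
    transitivity ((2^-1)%:E + (2^-1)%:E : \bar R)%E; first by congr (_ + _)%E.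
    by rewrite -EFinD; congr (_%:E); field.
  apply/seteqP; split => // w [/= -> ]; lra.
apply/eqP; rewrite -measure_le0.
have <- : P (~` (xi m @^-1` ([set 1] `|` [set -1]))) = 0%E.
  rewrite probability_setC; last by apply: mxi; exact: measurableU.
  by rewrite PB subee.
apply: le_measure; rewrite ?inE.
- have -> : [set w | ~ `|xi m w| <= 1] = xi m @^-1` (~` `[-1, 1]).
    apply/seteqP; split => w /=; by rewrite in_itv/= ler_norml.
  by apply: mxi; exact: measurableC.
- by apply: measurableC; apply: mxi; exact: measurableU.
- move=> w /= nle [e|e]; apply: nle; rewrite e ?normrN normr1//.
Qed.

End Market.

Lemma one_step_gain_negligible (d : measure_display) (T : measurableType d)
    (R : realType) (P : probability T R) (H sigma s0 : R)
    (xi : nat -> {RV P >-> R}) (N : nat) (lam c : R) (phi : strategy T R) :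
  iid_fair_signs xi -> 0 < s0 -> 0 < lam < 1 -> 0 < c ->
  (forall m (z : seq R), (0 < m <= N)%N -> (forall i, `|z`_i| <= 1) ->
    `|Xval H sigma m z / N%:R `^ H| < lam) ->
  one_step_self_financing H sigma s0 xi N lam phi ->
  P [set w | c <= liquidation_value H sigma s0 xi N lam phi N w] = 0%E.
Proof.
move=> iid s00 l01 c0 Xl sf.
have [m m0 le0] := one_step_liquidation_le0 s00 l01 Xl sf.
have mxi : measurable [set w | ~ (`|xi m w| <= 1)].
  rewrite (_ : mkset _ = xi m @^-1` (~` `[-1, 1])).
    rewrite -[X in measurable X]setTI; apply: measurable_funPT => //.
    exact: measurableC.
  by apply/seteqP; split => w /=; rewrite in_itv/= ler_norml.
apply/eqP; rewrite -measure_le0 -(fair_sign_bounded_ae iid m0).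
apply: le_measure; rewrite ?inE//.
  (* Monotonicity of the measure requires the gain event to be measurable; adaptedness provides
     this, the terminal value being the bond account. *)
  rewrite (_ : mkset _ = bond_units phi N @^-1` `[c, +oo[).
    case: sf => ad _; apply: (@filtration_measurable _ _ _ _ xi N%:Z).
    by have [] := ad N%:Z `[c, +oo[%classic; rewrite ?lexx.
  apply/seteqP; split => w /=; rewrite liquidation_value_terminal// in_itv/= andbT//.
by move=> w /= cw /le0 vle; move: (lt_le_trans c0 (le_trans cw vle)); rewrite ltxx.
Qed.

(** * Absence of both kinds of arbitrage *)

(** Common core of both kinds: the thresholds [c] are the C_N for the first and the constant alpha
    for the second. The probabilities are eventually 0, whereas arbitrage demands a limit l > 0 or l
    = 1. *)
Lemma one_step_gain_limit (d : measure_display) (T : measurableType d)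
    (R : realType) (P : probability T R) (H sigma s0 : R)
    (xi : nat -> {RV P >-> R}) (lam : nat -> R) (u : nat -> nat)
    (phi : nat -> strategy T R) (c : nat -> R) (l : R) :
  1 / 2 < H < 1 -> 0 < s0 -> iid_fair_signs xi ->
  (forall N : nat, (1 <= N)%N -> 0 < lam N < 1) ->
  (fun N : nat => lam N * Num.sqrt N%:R) @ \oo --> +oo ->
  {homo u : k k' / (k < k')%N} -> (forall k, 0 < c k) ->
  (forall k, (1 < u k)%N /\
    one_step_self_financing H sigma s0 xi (u k) (lam (u k)) (phi k)) ->
  (fun k => P [set w | c k <=
     liquidation_value H sigma s0 xi (u k) (lam (u k)) (phi k) (u k) w])
    @ \oo --> l%:E ->
  l = 0.
Proof.
move=> Hr s00 iid lam01 lamoo u_incr c0 sf Pl.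
have [C C0 XC] := relative_return_bound sigma Hr.
(* A strictly increasing sequence of naturals dominates the identity, so a threshold valid for N is
   valid along the subsequence. *)
have u_ge k : (k <= u k)%N.
  by elim: k => // k IH; apply: leq_ltn_trans IH (u_incr _ _ _).
have /cvgryPgt/(_ C)[K _ CK] := lamoo.
have P0 : (fun k => P [set w | c k <=
     liquidation_value H sigma s0 xi (u k) (lam (u k)) (phi k) (u k) w])
    @ \oo --> 0%E.
  apply: cvg_near_cst; exists K => // k /= Kk; have [uk1 sfk] := sf k.
  apply: one_step_gain_negligible => //; first by rewrite lam01// ltnW.
  move=> m z mN z1; apply: le_lt_trans (XC _ _ _ mN z1) _.
  rewrite ltr_pdivrMr ?sqrtr_gt0 ?ltr0n ?(ltn_trans _ uk1)//.
  by apply: CK => /=; exact: leq_trans (u_ge k).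
by apply: EFin_inj; apply: cvg_unique Pl P0; exact: ereal_hausdorff.
Qed.

Theorem theorem5p2 (d : measure_display) (T : measurableType d) (R : realType)
    (P : probability T R) (H sigma s0 : R) (xi : nat -> {RV P >-> R})
    (lam : nat -> R)
    (H_range : 1 / 2 < H < 1) (sigma_gt0 : 0 < sigma) (s0_gt0 : 0 < s0)
    (xi_iid : iid_fair_signs xi)
    (lam_range : forall N : nat, (1 <= N)%N -> 0 < lam N < 1)
    (lam_sqrt : (fun N : nat => lam N * Num.sqrt N%:R) @ \oo --> +oo) :
  ~ asymptotic_arbitrage1 H sigma s0 xi lam /\
  ~ asymptotic_arbitrage2 H sigma s0 xi lam.
Proof.
split.
- move=> [u [phi [c [C [ui [sf [cC [_ [_ [_ [l [l0 Pl]]]]]]]]]]]].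
  have C0 k : 0 < C k by have [] := cC k.
  have := one_step_gain_limit H_range s0_gt0 xi_iid lam_range lam_sqrt ui C0 sf Pl.
  by move=> lE; move: l0; rewrite lE ltxx.
- move=> [u [phi [al [ui [sf [al0 [_ Pl]]]]]]].
  have := one_step_gain_limit H_range s0_gt0 xi_iid lam_range lam_sqrt ui
    (fun _ => al0) sf Pl.
  by move/eqP; rewrite oner_eq0.
Qed.
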